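(* For all sufficiently large $N'\in\mathbb{N}$ there are two random probability measures $\mu,\nu$ on $\mathbb{R}$ with distinct distributions, which are a.s. supported in $\{0,\dots,N'-1\}$, such that for every $t\in\mathbb{R}$ the complex-valued random variables $\phi_\mu(t)$ and $\phi_\nu(t)$ have the same distribution.
   Context: A random probability measure is a random variable with values in the set $P(\mathbb{R})$ of Borel probability measures on $\mathbb{R}$, equipped with the $\sigma$-algebra generated by the maps $\mu\mapsto\mu(B)$, $B\subset\mathbb{R}$ Borel. $\phi_\mu(t)=\int_{\mathbb{R}}e^{itx}\,d\mu(x)$ is the (random) characteristic function of $\mu$. *)

(* Defs.v *)
From HB Require Import structures.
From mathcomp Require Import all_boot all_order all_algebra.
From mathcomp Require Import all_classical all_reals all_analysis.
From mathcomp Require Import measurable_realfun complex.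
From mathcomp Require Import ring lra.
Set Implicit Arguments.
Unset Strict Implicit.
Unset Printing Implicit Defensive.
Import Order.TTheory GRing.Theory Num.Theory.
Import numFieldNormedType.Exports.
Local Open Scope classical_set_scope.
Local Open Scope ring_scope.
Local Open Scope complex_scope.

(* The topology on [R[i]^o] is the one induced by the modulus, so this is C
   with its Borel sigma-algebra. *)
Definition borelC (R : realType) : measurableType (@open R[i]^o).-sigma :=
  g_sigma_algebraType (@open R[i]^o).

Definition expi (R : realType) (x : R) : R[i] := cos x +i* sin x.

(* [\int] is real-valued here ([Rintegral]); only bounded integrands matter
   below, so no infinite value is truncated. *)
Definition cintegral d (T : measurableType d) (R : realType)
    (mu : {measure set T -> \bar R}) (f : T -> R[i]) : R[i] :=
  (\int[mu]_(x in setT) complex.Re (f x)) +i*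
  (\int[mu]_(x in setT) complex.Im (f x)).

Definition charfun (R : realType) (t : R) (mu : pprobability R R) : borelC R :=
  cintegral (mu : probability R R) (fun x : R => expi (t * x)).

Lemma complex_box_bound (R : realType) (z w : R[i]) (e : R) :
  `|complex.Re z - complex.Re w| < e / 2 ->
  `|complex.Im z - complex.Im w| < e / 2 ->
  `|z - w| < e%:C.
Proof.
case: z w => [a b] [c f] /= h1 h2.
have -> : (a +i* b) - (c +i* f) = (a - c)%:C + 'i * (b - f)%:C.
  by simpc.
apply: le_lt_trans (ler_normD _ _) _.
rewrite normrM.
have -> : `|'i : R[i]| = 1 by rewrite normc_def /= expr0n expr1n add0r sqrtr1.
rewrite mul1r !normc_def /= !expr0n !addr0 !sqrtr_sqr -rmorphD ltcR.
by rewrite [e]splitr ltrD.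
Qed.

Lemma measurable_borelC d (T : measurableType d) (R : realType) (X Y : T -> R) :
  measurable_fun [set: T] X -> measurable_fun [set: T] Y ->
  measurable_fun [set: T] (fun w => (X w +i* Y w) : borelC R).
Proof.
move=> mX mY.
apply: (@measurability _ _ _ (borelC R) _ _ (@open R[i]^o) erefl).
move=> _ [U oU <-]; rewrite setTI.
pose I (q : rat) (n : nat) : set R :=
  `](ratr q - n.+1%:R^-1), (ratr q + n.+1%:R^-1)[%classic.
pose box (p : rat * rat * nat) : set T :=
  (X @^-1` I p.1.1 p.2) `&` (Y @^-1` I p.1.2 p.2).
pose inU (p : rat * rat * nat) :=
  forall a b : R, I p.1.1 p.2 a -> I p.1.2 p.2 b -> U (a +i* b).
have -> : (fun w => X w +i* Y w) @^-1` U = \bigcup_(p in inU) box p.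
  apply/seteqP; split => [w /= Uw|w [p Ip [/= h1 h2]]]; last exact: Ip.
  have : nbhs (X w +i* Y w : R[i]^o) U by exact: open_nbhs_nbhs.
  move=> /nbhs_ballP[e /= e0 He].
  have [e1 e10 ee] : exists2 e1 : R, 0 < e1 & e = e1%:C.
    case: e e0 {He} => [x y]; rewrite ltcE /= => /andP[/eqP -> x0].
    by exists x.
  have [n n_lt] : exists n : nat, (n.+1%:R^-1 : R) < e1 / 4.
    exists (Num.truncn (e1 / 4)^-1).
    rewrite invf_plt ?posrE ?divr_gt0//.
    exact: truncnS_gt.
  have n0 : (0 : R) < n.+1%:R^-1 by rewrite invr_gt0.
  have approx (x : R) : exists q : rat, I q n x.
    have /rat_in_itvoo[q] : x - n.+1%:R^-1 < x + n.+1%:R^-1.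
      by rewrite ltrD2l gtrN.
    rewrite in_itv /= => /andP[? ?]; exists q.
    rewrite /I /= in_itv /=; apply/andP.
    by split; [rewrite ltrBlDr|rewrite -ltrBlDr].
  have [q1 hq1] := approx (X w); have [q2 hq2] := approx (Y w).
  exists (q1, q2, n) => //= a b /= ha hb.
  have close (q : rat) (x y : R) : I q n x -> I q n y -> `|x - y| < e1 / 2.
    rewrite /I /= !in_itv /=.
    move: n_lt; move: (n.+1%:R^-1 : R) (ratr q : R) => r p ? /andP[? ?] /andP[? ?].
    by rewrite ltr_norml; apply/andP; split; lra.
  apply: He; rewrite -ball_normE /= ee.
  apply: complex_box_bound => /=; [exact: close hq1 ha|exact: close hq2 hb].
rewrite bigcup_mkcond; apply: countable_bigcupT_measurable => // p.
case: ifPn => // _.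
apply: measurableI; rewrite -[X in measurable X]setTI;
  [apply: mX => //|apply: mY => //]; exact: measurable_itv.
Qed.

Lemma measurable_Rintegral_pprobability (R : realType) (f : R -> R) :
  measurable_fun [set: R] f ->
  measurable_fun [set: pprobability R R]
    (fun mu => \int[(mu : probability R R)]_(x in setT) f x).
Proof.
move=> mf.
pose k := kprobability (@measurable_id _ (pprobability R R) setT).
have mI (g : R -> \bar R) :
    (forall x, 0 <= g x)%E -> measurable_fun [set: R] g ->
    measurable_fun [set: pprobability R R]
      (fun mu => \int[(mu : probability R R)]_x g x)%E.
  move=> g0 mg.
  apply: (@measurable_fun_integral_kernel _ _ _ _ _
    (fun mu : pprobability R R => k mu)) => // U mU.
  exact: (measurable_kernel k).
rewrite /Rintegral; apply: measurableT_comp => //.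
under eq_fun do rewrite integralE.
apply: emeasurable_funB; apply: mI => //.
- by apply: measurable_funepos; exact/measurable_EFinP.
- by apply: measurable_funeneg; exact/measurable_EFinP.
Qed.

Lemma measurable_charfun (R : realType) (t : R) :
  measurable_fun [set: pprobability R R] (charfun t).
Proof.
apply: measurable_borelC; apply: measurable_Rintegral_pprobability => /=.
- apply: measurableT_comp.
    by apply: continuous_measurable_fun; exact: continuous_cos.
  exact: mulrl_measurable.
- apply: measurableT_comp.
    by apply: continuous_measurable_fun; exact: continuous_sin.
  exact: mulrl_measurable.
Qed.

HB.instance Definition _ (R : realType) (t : R) :=
  isMeasurableFun.Build _ _ (pprobability R R) (borelC R) (charfun t)
    (measurable_charfun t).

(* Measures are total functions on sets, so laws are compared on measurable
   sets only. *)
Definition eq_law d d' (T : measurableType d) (T' : measurableType d')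
    (R : realType) (P : probability T R) (X Y : {RV P >-> T'}) : Prop :=
  forall A : set T', measurable A -> distribution P X A = distribution P Y A.
Arguments eq_law {d d' T T' R} P X Y.

(* Main.v *)
Require Import Defs.
From HB Require Import structures.
From mathcomp Require Import all_boot all_order all_algebra.
From mathcomp Require Import all_classical all_reals all_analysis.
From mathcomp Require Import measurable_realfun complex.
From mathcomp Require Import ring lra.
Set Implicit Arguments.
Unset Strict Implicit.
Unset Printing Implicit Defensive.
Import Order.TTheory GRing.Theory Num.Theory.
Import numFieldNormedType.Exports.
Local Open Scope classical_set_scope.
Local Open Scope ring_scope.

(* Let c + i s be uniform on the unit circle and y(z) = (1 + z^2)(c + z s) + z(-+ s +- z c), a
   random polynomial of degree at most 3. For |z| = 1 we have 1 + z^2 = z S with S = 2 Re z real,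
   so y(z) / z is the vector S(c, s) +- (-s, c), paired with (1, z); for either sign this vector
   is uniform on the circle of radius sqrt(1 + S^2), the second one being a rotation of the first
   by an angle depending on z only. Hence 1/5 (1 + ... + z^4) + 1/15 (1 - z) y(z), whose
   coefficients are the weights of a probability measure on {0, ..., 4}, has the same law for
   both signs at every z = e^(it), although the joint laws of the coefficients differ: the mass
   of {0, 1} is constant for the upper sign only. *)

(** * Uniform law on an interval and its invariance under rotation *)

Lemma lebesgue_measure_translation (R : realType) (a : R) (A : set R) :
  measurable A ->
  lebesgue_measure ((fun x => x + a) @^-1` A) = lebesgue_measure A.
Proof.
have ma : measurable_fun [set: R] (fun x => x + a).
  exact: measurable_funD.
move=> mA; apply/esym.
rewrite -[RHS]/(pushforward lebesgue_measure
  ((fun x => x + a) : R -> measurableTypeR R) A).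
apply: lebesgue_measure_unique => //= _ [[x y] _ <-].
rewrite /pushforward /=.
have -> : (fun x => x + a) @^-1` `]x, y]%classic = `]x - a, y - a]%classic.
  by apply/seteqP; split => z /=; rewrite !in_itv /= ltrBlDr lerBrDr.
rewrite !lebesgue_measure_itv /= !lte_fin ltrD2r.
by case: ifP => // _; rewrite -!EFinD; congr EFin; ring.
Qed.

(** The density lives on a closed interval; dropping the null endpoint [a] gives half-open
    intervals, which can be cut and glued without overlap. *)
Lemma uniform_probE (R : realType) (a b : R) (ab : a < b) (A : set R) :
  measurable A ->
  uniform_prob ab A = ((b - a)^-1%:E * lebesgue_measure (A `&` `]a, b]))%E.
Proof.
move=> mA; rewrite /uniform_prob integral_uniform_pdf.
rewrite (eq_integral (fun=> (b - a)^-1%:E)); last first.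
  by move=> x; rewrite inE => -[_] /=; rewrite in_itv /= /uniform_pdf => ->.
rewrite integral_cst/=; last exact: measurableI.
congr *%E.
rewrite -(setU1itv false) ?bnd_simp; last exact: ltW.
rewrite setIUr measureU; [|by apply: measurableI..|].
- rewrite [X in (X + _)%E](_ : _ = 0%E) ?add0e//.
  apply: (subset_measure0 _ _ _ (lebesgue_measure_set1 a)) => //.
  exact: measurableI.
- apply/seteqP; split => // x [[_ /= ->] [_]].
  by rewrite /= in_itv /= ltxx.
Qed.

(** Rotation invariance of the uniform law on the circle of length [T], with events on the circle
    given as [T]-periodic sets. *)
Lemma uniform_prob_periodic (R : realType) (T b : R) (T0 : 0 < T)
    (A : set R) :
  measurable A -> (forall x, A (x + T) <-> A x) -> 0 <= b <= T ->
  uniform_prob T0 ((fun x => x + b) @^-1` A) = uniform_prob T0 A.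
Proof.
move=> mA perA /andP[b0 bT].
have mb c : measurable ((fun x => x + c) @^-1` A).
  rewrite -[X in measurable X]setTI.
  by apply: (_ : measurable_fun setT _) => //; exact: measurable_funD.
rewrite !uniform_probE//; congr *%E.
pose I (x y : R) : set R := `]x, y]%classic.
have mI x y : measurable (I x y) by exact: measurable_itv.
have itvU x y z : x <= y -> y <= z ->
    lebesgue_measure (A `&` I x z) =
    (lebesgue_measure (A `&` I x y) + lebesgue_measure (A `&` I y z))%E.
  move=> xy yz; rewrite -measureU; [|by apply: measurableI => //; exact: mI..|].
    rewrite -setIUr; congr (_ (_ `&` _)); apply/seteqP; split=> u /=.
      rewrite /I /= !in_itv /= => /andP[-> uz].
      by case: (leP u y) => _; [left|right].
    rewrite /I /= !in_itv /= => -[/andP[xu uy]|/andP[yu ->]].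
      by rewrite xu (le_trans uy).
    by rewrite (le_lt_trans xy).
  apply/seteqP; split => // u [[_ ] + [_]].
  by rewrite /I /= !in_itv /= => /andP[_ uy] /andP[]; rewrite ltNge uy.
have -> : (fun x => x + b) @^-1` A `&` I 0 T =
    (fun x => x + b) @^-1` (A `&` I b (T + b)).
  apply/seteqP; split => u /=; rewrite /I /= !in_itv /=;
    by rewrite lerD2r ltrDr.
rewrite lebesgue_measure_translation; last exact: measurableI.
(* The windows []b, T + b]] and []0, T]] share []b, T]]; periodicity matches the leftover []T, T +
   b]] with []0, b]]. *)
rewrite (itvU b T (T + b))// ?lerDl// (itvU 0 b T)// addeC; congr adde.
rewrite -(@lebesgue_measure_translation _ T); last exact: measurableI.
congr lebesgue_measure; apply/seteqP; split => u /=; rewrite /I /= !in_itv /=;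
  rewrite [T + b]addrC lerD2r ltrDr => -[? ?]; split => //;
  exact/perA.
Qed.

(** * Measures on finitely many integers and their weights *)

Section finite_support.
Variables (R : realType) (p : nat -> R).

Definition atoms (n : nat) (p0 : forall k, 0 <= p k)
    (p1 : \sum_(k < n) p k = 1) : set R -> \bar R :=
  msum (fun k => mscale (NngNum (p0 k)) \d_(k%:R : R)) n.

Variables (n : nat) (p0 : forall k, 0 <= p k) (p1 : \sum_(k < n) p k = 1).

HB.instance Definition _ := Measure.on (atoms p0 p1).

Lemma atomsE (A : set R) :
  atoms p0 p1 A = (\sum_(k < n) p k * \1_A (k%:R : R))%:E.
Proof. by rewrite /atoms /msum -sumEFin. Qed.

Let atoms_setT : atoms p0 p1 [set: R] = 1%E.
Proof. by rewrite atomsE; under eq_bigr do rewrite indicT mulr1; rewrite p1. Qed.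

HB.instance Definition _ :=
  Measure_isProbability.Build _ _ _ (atoms p0 p1) atoms_setT.

Lemma Rintegral_atoms (f : R -> R) : measurable_fun [set: R] f ->
  \int[atoms p0 p1]_x f x = \sum_(k < n) p k * f k%:R.
Proof.
move=> mf.
have mEf : measurable_fun setT (EFin \o f) by exact/measurable_EFinP.
have ge0_int (g : R -> \bar R) : (forall x, 0 <= g x)%E ->
    measurable_fun [set: R] g ->
    (\int[atoms p0 p1]_x g x = \sum_(k < n) (p k)%:E * g k%:R)%E.
  move=> g0 mg; rewrite ge0_integral_measure_sum//; apply: eq_bigr => k _.
  by rewrite ge0_integral_mscale// integral_dirac// diracT mul1e.
rewrite /Rintegral integralE !ge0_int//; last first.
- exact: measurable_funepos.
- exact: measurable_funeneg.
rewrite funerpos funerneg /=.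
under eq_bigr do rewrite -EFinM.
under [X in (_ - X)%E]eq_bigr do rewrite -EFinM.
rewrite !sumEFin -EFinB /= -sumrB; apply: eq_bigr => k _.
by rewrite -mulrBr -[in RHS](funrposBneg f).
Qed.

End finite_support.

(* The weights are [1/5 + (y_k - y_(k-1)) / 15], where [y = (c, 0, 2c, s)] if [b] and
   [y = (c, 2s, 0, s)] otherwise, with [y_(-1) = y_4 = 0]. *)
Definition weight (R : realType) (b : bool) (c s : R) (k : nat) : R :=
  5^-1 + 15^-1 *
    ((if b then [:: 1; -1; 2; -2] else [:: 1; -1])`_k * c +
     (if b then [:: 0; 0; 0; 1; -1] else [:: 0; 2; -2; 1; -1])`_k * s).

(** At each index the coefficients of [c] and [s] have absolute values adding up to at most 3, and
    3/15 = 1/5: this dictates the factor 1/15. Past the lists the default coefficient is 0. *)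
Lemma weight_ge0 (R : realType) (b : bool) (c s : R) :
  -1 <= c <= 1 -> -1 <= s <= 1 -> forall k, 0 <= weight b c s k.
Proof.
move=> /andP[? ?] /andP[? ?].
by rewrite /weight; case: b => -[|[|[|[|[|k]]]]] /=; rewrite ?nth_nil; lra.
Qed.

Lemma weight_sum1 (R : realType) (b : bool) (c s : R) :
  \sum_(k < 5) weight b c s k = 1.
Proof. by rewrite !big_ord_recr big_ord0 /weight; case: b => /=; lra. Qed.

(** Summation by parts leaves the differences [e k - e k.+1], which the recurrence reduces to
    [e 1 - e 2] and [e 2 - e 3]. Their coefficients are [x * c - s] and [x * s + c] on the left,
    [x * c' + s'] and [x * s' - c'] on the right. The sequences of interest are the real and
    imaginary parts of z^k, with x = 2 Re z. *)
Lemma weight_recurrence (R : realType) (x c s c' s' : R) (e : nat -> R) :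
  (forall k, e k.+2 + e k = x * e k.+1) ->
  x * c' + s' = x * c - s -> x * s' - c' = x * s + c ->
  \sum_(k < 5) weight true c s k * e k = \sum_(k < 5) weight false c' s' k * e k.
Proof.
move=> rec h1 h2.
have e2 : e 2 = x * e 1 - e 0 by rewrite -rec addrK.
have e3 : e 3 = x * e 2 - e 1 by rewrite -rec addrK.
have e4 : e 4 = x * e 3 - e 2 by rewrite -rec addrK.
rewrite !big_ord_recr !big_ord0 /weight /= e4 e3 e2.
apply/eqP; rewrite -subr_eq0; apply/eqP.
transitivity (15^-1 * ((e 1 - e 2) * ((x * c - s) - (x * c' + s')) +
                       (e 2 - e 3) * ((x * s + c) - (x * s' - c')))).
  by rewrite e3 e2; ring.
by rewrite h1 h2 !subrr !mulr0 addr0 mulr0.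
Qed.

(** * Trigonometric recurrence and the rotation angle *)

Lemma trig_recurrence (R : realType) (t : R) (k : nat) :
  cos (t * k.+2%:R) + cos (t * k%:R) = (2 * cos t) * cos (t * k.+1%:R) /\
  sin (t * k.+2%:R) + sin (t * k%:R) = (2 * cos t) * sin (t * k.+1%:R).
Proof.
have -> : t * k.+2%:R = t * k.+1%:R + t by rewrite -(natr1 k.+1); ring.
have -> : t * k%:R = t * k.+1%:R - t by rewrite -(natr1 k); ring.
by rewrite !cosD !sinD !sinN !cosN; split; ring.
Qed.

(** The angle is twice the argument of x + i, since (x + i)^2 = (x^2 - 1) + 2xi has modulus 1 + x^2.
    Equivalently, e^(ib) = (x + i) / (x - i). *)
Lemma exists_angle (R : realType) (x : R) :
  exists b : R, [/\ 0 <= b <= pi *+ 2,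
    (1 + x ^+ 2) * cos b = x ^+ 2 - 1 & (1 + x ^+ 2) * sin b = 2 * x].
Proof.
pose r := Num.sqrt (1 + x ^+ 2).
have x1 : 0 < 1 + x ^+ 2 by rewrite ltr_pwDl// sqr_ge0.
have r0 : 0 < r by rewrite sqrtr_gt0.
have r2 : r ^+ 2 = 1 + x ^+ 2 by rewrite sqr_sqrtr// ltW.
have xr : -1 <= x / r <= 1.
  rewrite -ler_norml -(@ler_pXn2r _ 2)// ?nnegrE// real_normK ?num_real//.
  by rewrite expr1n expr_div_n r2 ler_pdivrMr// mul1r lerDr.
have sin_a : sin (acos (x / r)) = r^-1.
  rewrite sin_acos// expr_div_n.
  have -> : 1 - x ^+ 2 / r ^+ 2 = (r^-1) ^+ 2.
    by field: r2; rewrite gt_eqF.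
  by rewrite sqrtr_sqr gtr0_norm// invr_gt0.
exists (acos (x / r) *+ 2).
rewrite mulr2n cosD sinD acosK// sin_a -r2; split.
- rewrite addr_ge0 ?acos_ge0//= mulr2n lerD// acos_lepi//.
- by field: r2; rewrite gt_eqF.
- by field; rewrite gt_eqF.
Qed.

Lemma cos_bounds (R : realType) (x : R) : -1 <= cos x <= 1.
Proof. by rewrite cos_geN1 cos_le1. Qed.

Lemma sin_bounds (R : realType) (x : R) : -1 <= sin x <= 1.
Proof. by rewrite sin_geN1 sin_le1. Qed.

(** * The two random measures and their characteristic functions *)

Section random_atoms.
Variables (R : realType) (b : bool).

Definition random_atoms (x : R) : pprobability R R :=
  atoms (weight_ge0 b (cos_bounds x) (sin_bounds x))
        (weight_sum1 b (cos x) (sin x)).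

Lemma random_atomsE (x : R) (A : set R) : (random_atoms x : probability R R) A =
  (\sum_(k < 5) weight b (cos x) (sin x) k * \1_A (k%:R : R))%:E.
Proof. exact: atomsE. Qed.

Lemma measurable_weight (k : nat) :
  measurable_fun [set: R] (fun x => weight b (cos x) (sin x) k).
Proof.
have mcos : measurable_fun [set: R] (@cos R).
  by apply: continuous_measurable_fun; exact: continuous_cos.
have msin : measurable_fun [set: R] (@sin R).
  by apply: continuous_measurable_fun; exact: continuous_sin.
by rewrite /weight; apply: measurable_funD => //; apply: measurable_funM => //;
  apply: measurable_funD; exact: measurable_funM.
Qed.

Lemma measurable_random_atoms : measurable_fun [set: R] random_atoms.
Proof.
apply: (measurability (@pset _ _ _ : set (set (pprobability R R)))) => //.
move=> _ [_ [r _ [U mU <-]] <-].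
apply: emeasurable_fun_infty_o => //=.
under eq_fun do rewrite atomsE.
apply/measurable_EFinP; apply: measurable_sum => k.
by apply: measurable_funM => //; exact: measurable_weight.
Qed.

Lemma random_atoms_support (N : nat) (x : R) : (5 <= N)%N ->
  (random_atoms x : probability R R) [set k%:R | k in `I_N] = 1%E.
Proof.
move=> N5; rewrite random_atomsE -[in RHS](weight_sum1 b (cos x) (sin x)).
congr EFin; apply: eq_bigr => k _.
by rewrite indicE mem_set ?mulr1//; exists k => //=; exact: leq_trans N5.
Qed.

Lemma charfun_random_atoms (t x : R) : charfun t (random_atoms x) =
  ((\sum_(k < 5) weight b (cos x) (sin x) k * cos (t * k%:R)) +i*
   (\sum_(k < 5) weight b (cos x) (sin x) k * sin (t * k%:R)))%C.
Proof.
have mt : measurable_fun [set: R] (fun x => t * x) by exact: mulrl_measurable.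
rewrite /charfun /cintegral !Rintegral_atoms//; apply: measurableT_comp => //.
  by apply: continuous_measurable_fun; exact: continuous_sin.
by apply: continuous_measurable_fun; exact: continuous_cos.
Qed.

(** The half-line isolates the atoms 0 and 1, where the weights telescope to 2/5 + y_1/15, with y_1
    = 0 or 2 sin x. *)
Lemma random_atoms_mass01 (x : R) :
  (random_atoms x : probability R R) `]-oo, 3 / 2[%classic =
  (2 / 5 + (if b then 0 else 2 / 15 * sin x))%:E.
Proof.
have ind (k : nat) : \1_`]-oo, 3 / 2[ (k%:R : R) = (k < 2)%:R.
  rewrite indicE mem_setE in_itv /=; congr (nat_of_bool _)%:R.
  case: ltnP => k2; [apply/idP|apply/negbTE; rewrite -leNgt].
    by have : (k%:R : R) <= 1; [rewrite lern1|lra].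
  by have : 2 <= (k%:R : R); [rewrite ler_nat|lra].
rewrite random_atomsE !big_ord_recr big_ord0 /= !ind /weight /=; congr EFin.
by case: b => /=; lra.
Qed.

End random_atoms.

Lemma charfun_random_atoms_shift (R : realType) (t : R) :
  exists2 a : R, 0 <= a <= pi *+ 2 & forall x,
    charfun t (random_atoms true x) = charfun t (random_atoms false (x + a)).
Proof.
pose s := 2 * cos t.
have [a [a0 cos_a sin_a]] := exists_angle s.
exists a => // x; rewrite !charfun_random_atoms.
have s0 : 1 + s ^+ 2 != 0 by rewrite gt_eqF// ltr_pwDl// sqr_ge0.
(* [h1] and [h2] are the real and imaginary parts of (s - i) e^(i(x + a)) = (s + i) e^(ix). *)
have h1 : s * cos (x + a) + sin (x + a) = s * cos x - sin x.
  apply: (mulfI s0); rewrite cosD sinD.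
  transitivity (s * (cos x * ((1 + s ^+ 2) * cos a) -
      sin x * ((1 + s ^+ 2) * sin a)) +
    (sin x * ((1 + s ^+ 2) * cos a) + cos x * ((1 + s ^+ 2) * sin a))).
    by ring.
  by rewrite cos_a sin_a; ring.
have h2 : s * sin (x + a) - cos (x + a) = s * sin x + cos x.
  apply: (mulfI s0); rewrite cosD sinD.
  transitivity (s * (sin x * ((1 + s ^+ 2) * cos a) +
      cos x * ((1 + s ^+ 2) * sin a)) -
    (cos x * ((1 + s ^+ 2) * cos a) - sin x * ((1 + s ^+ 2) * sin a))).
    by ring.
  by rewrite cos_a sin_a; ring.
congr (_ +i* _)%C.
- apply: (@weight_recurrence _ s _ _ _ _ (fun k => cos (t * k%:R))) => // k.
  exact: (trig_recurrence t k).1.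
- apply: (@weight_recurrence _ s _ _ _ _ (fun k => sin (t * k%:R))) => // k.
  exact: (trig_recurrence t k).2.
Qed.

Lemma uniform_prob_sin_lt0 (R : realType) (T0 : (0 : R) < pi *+ 2) :
  (0 < uniform_prob T0 [set x | (sin x < 0)%R])%E.
Proof.
have sinN : `]pi, (pi *+ 2)[%classic `<=` [set x : R | sin x < 0].
  move=> x /=; rewrite in_itv /= => /andP[x1 x2].
  rewrite -[x](subrK pi) sinDpi oppr_lt0 sin_gt0_pi// subr_gt0 x1/=.
  by rewrite ltrBlDr -mulr2n.
have msin : measurable [set x : R | sin x < 0].
  rewrite -[X in measurable X]setTI.
  apply: measurable_fun_ltr => //.
  by apply: continuous_measurable_fun; exact: continuous_sin.
rewrite uniform_probE// mule_gt0 ?lte_fin ?invr_gt0 ?subr_gt0//.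
apply: (@lt_le_trans _ _ (lebesgue_measure `]pi, (pi *+ 2)[%classic)).
  rewrite lebesgue_measure_itv /= lte_fin mulr2n ltrDl pi_gt0.
  by rewrite -EFinB lte_fin addrK pi_gt0.
apply: le_measure; rewrite ?inE//.
  exact: measurableI.
move=> x xI; split; first exact: sinN.
move: xI; rewrite /= !in_itv /= => /andP[x1 /ltW ->].
by rewrite (lt_trans (pi_gt0 _) x1).
Qed.

Theorem theorem4p1p4 (R : realType) :
  exists N0 : nat, forall N : nat, (N0 <= N)%N ->
  exists (d : measure_display) (Omega : measurableType d)
    (P : probability Omega R) (mu nu : {RV P >-> pprobability R R}),
    [/\ ~ eq_law P mu nu,
        {ae P, forall w, (mu w : probability R R) [set k%:R | k in `I_N] = 1%E},
        {ae P, forall w, (nu w : probability R R) [set k%:R | k in `I_N] = 1%E} &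
        forall t : R, eq_law P (charfun t \o mu) (charfun t \o nu)].
Proof.
have T0 : (0 : R) < pi *+ 2 by rewrite mulrn_wgt0// pi_gt0.
exists 5%N => N N5.
pose rv b : {RV (uniform_prob T0) >-> pprobability R R} :=
  HB.pack (random_atoms b) (isMeasurableFun.Build _ _ (measurableTypeR R)
    (pprobability R R) _ (@measurable_random_atoms R b)).
exists _, _, (uniform_prob T0), (rv true), (rv false).
split.
(* The event that the mass of {0, 1} is strictly below 2/5: impossible for [rv true], where the mass
   equals 2/5, and equivalent to sin x < 0 for [rv false]. *)
- pose A : set (pprobability R R) := @mset _ R R `]-oo, 3 / 2[%classic (2 / 5).
  have mA : measurable A.
    apply: sub_sigma_algebra; exists (2 / 5).
      by rewrite /= in_itv /=; apply/andP; split; lra.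
    by exists `]-oo, 3 / 2[%classic.
  move=> /(_ A mA); rewrite /distribution /pushforward /=.
  have -> : random_atoms true @^-1` A = set0.
    apply/seteqP; split => // x; rewrite /A /mset /=.
    by rewrite random_atoms_mass01 addr0 ltxx.
  have -> : random_atoms false @^-1` A = [set x | sin x < 0].
    apply/seteqP; split => x; rewrite /A /mset /= random_atoms_mass01 lte_fin;
      lra.
  rewrite measure0 => /esym P0.
  by have := uniform_prob_sin_lt0 T0; rewrite P0 ltxx.
- by apply: aeW => x; exact: random_atoms_support.
- by apply: aeW => x; exact: random_atoms_support.
- move=> t A mA; have [a a0 shift] := charfun_random_atoms_shift t.
  rewrite /distribution /pushforward /=.
  (* The angle [a] depends on [t] but not on [x], so the two events differ by a rotation, which
     preserves the uniform law. *)
  have -> : (charfun t \o random_atoms true) @^-1` A =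
      (fun x => x + a) @^-1` ((charfun t \o random_atoms false) @^-1` A).
    by apply/seteqP; split => x /=; rewrite shift.
  apply: uniform_prob_periodic => // [|x].
    rewrite -[X in measurable X]setTI.
    have mc := measurableT_comp (measurable_charfun t)
      (@measurable_random_atoms R false).
    exact: mc.
  by rewrite /= !charfun_random_atoms cosD2pi sinD2pi.
Qed.
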